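(* Let $p$ be an odd prime and let $q\in\mathbb{C}_p$ with $|q-1|_p<1$. Then, as formal power series in $t$ over $\mathbb{C}_p$, $$\int_{\mathbb{Z}_p}e^{tx}\,d\mu_{-q}(x)=\frac{1+q}{qe^t+1}=\sum_{n=0}^{\infty}H_n(-q^{-1})\frac{t^n}{n!}.$$
   Context: $\mathbb{C}_p$ is the completion of the algebraic closure of $\mathbb{Q}_p$, with absolute value normalized by $|p|_p=1/p$. For an integer $x\ge 0$, $[x]_{-q}=\frac{1-(-q)^x}{1+q}$. For a function $g$ on $\mathbb{Z}_p$, $$\int_{\mathbb{Z}_p}g(x)\,d\mu_{-q}(x)=\lim_{N\to\infty}\frac{1}{[p^N]_{-q}}\sum_{x=0}^{p^N-1}g(x)(-q)^x .$$ The integral of $e^{tx}$ is understood coefficientwise in $t$, i.e. as $\sum_{n\ge0}\left(\int_{\mathbb{Z}_p}x^n\,d\mu_{-q}(x)\right)\frac{t^n}{n!}$. The Frobenius-Euler numbers $H_n(u)$, for $u\neq1$, are defined by $\frac{1-u}{e^t-u}=\sum_{n\ge0}H_n(u)\frac{t^n}{n!}$. *)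

(* Defs.v *)
From HB Require Import structures.
From mathcomp Require Import all_boot all_order all_algebra.
From mathcomp Require Import all_classical all_reals all_analysis.
Set Implicit Arguments.
Unset Strict Implicit.
Unset Printing Implicit Defensive.
Import Order.TTheory GRing.Theory Num.Theory.
Import numFieldNormedType.Exports.
Local Open Scope classical_set_scope.
Local Open Scope ring_scope.

(* [f`[n]] is the coefficient of t^n.  A record rather than a synonym of
   [nat -> K], which already carries the pointwise algebraic structures. *)
Record fps (K : fieldType) := Fps { fps_coef : nat -> K }.

Notation "f `[ n ]" := (fps_coef f n) (at level 2, format "f `[ n ]").

HB.instance Definition _ (K : fieldType) := gen_eqMixin (fps K).
HB.instance Definition _ (K : fieldType) := gen_choiceMixin (fps K).

Section FpsRing.
Variable K : fieldType.
Implicit Types f g h : fps K.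

Lemma fpsP f g : (forall n, f`[n] = g`[n]) -> f = g.
Proof. by case: f => f; case: g => g /= /funext ->. Qed.

Definition fps_zero : fps K := Fps (fun=> 0).
Definition fps_opp f : fps K := Fps (fun n => - f`[n]).
Definition fps_add f g : fps K := Fps (fun n => f`[n] + g`[n]).

Fact fps_addA : associative fps_add.
Proof. by move=> f g h; apply: fpsP => n /=; rewrite addrA. Qed.
Fact fps_addC : commutative fps_add.
Proof. by move=> f g; apply: fpsP => n /=; rewrite addrC. Qed.
Fact fps_add0 : left_id fps_zero fps_add.
Proof. by move=> f; apply: fpsP => n /=; rewrite add0r. Qed.
Fact fps_addN : left_inverse fps_zero fps_opp fps_add.
Proof. by move=> f; apply: fpsP => n /=; rewrite addNr. Qed.

HB.instance Definition _ :=
  GRing.isZmodule.Build (fps K) fps_addA fps_addC fps_add0 fps_addN.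

Definition fpsC (c : K) : fps K := Fps (fun n => if n is 0%N then c else 0).

Definition fps_mul f g : fps K :=
  Fps (fun n => \sum_(i < n.+1) f`[i] * g`[n - i]).

Definition fps_trunc (m : nat) f : {poly K} := \poly_(i < m) f`[i].

Lemma fps_mul_trunc m n f g : (n < m)%N ->
  (fps_mul f g)`[n] = (fps_trunc m f * fps_trunc m g)`_n.
Proof.
move=> nm; rewrite coefM /=; apply: eq_bigr => i _; rewrite !coef_poly.
by rewrite (leq_ltn_trans (leq_subr _ _) nm) (leq_trans (ltn_ord i) nm).
Qed.

Fact fps_mulC : commutative fps_mul.
Proof.
by move=> f g; apply: fpsP => n; rewrite !(@fps_mul_trunc n.+1)// mulrC.
Qed.

Fact fps_mulA : associative fps_mul.
Proof.
move=> f g h; apply: fpsP => n.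
have E a b c : (fps_mul a (fps_mul b c))`[n] =
    (fps_trunc n.+1 a * (fps_trunc n.+1 b * fps_trunc n.+1 c))`_n.
  rewrite /= coefM; apply: eq_bigr => i _.
  rewrite -(@fps_mul_trunc n.+1) ?ltnS ?leq_subr//.
  by rewrite coef_poly ltn_ord.
by rewrite [in RHS]fps_mulC !E [in RHS]mulrC mulrA.
Qed.

Fact fps_mul1 : left_id (fpsC 1) fps_mul.
Proof.
move=> f; apply: fpsP => n /=; rewrite big_ord_recl /= mul1r subn0.
by rewrite big1 ?addr0// => i _; rewrite /= mul0r.
Qed.

Fact fps_mulD : left_distributive fps_mul fps_add.
Proof.
move=> f g h; apply: fpsP => n /=; rewrite -big_split /=.
by apply: eq_bigr => i _; rewrite mulrDl.
Qed.

Fact fps_oner_neq0 : fpsC 1 != fps_zero.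
Proof.
apply/eqP => /(congr1 (fun f => f`[0])) /= /eqP.
by rewrite oner_eq0.
Qed.

HB.instance Definition _ :=
  GRing.Zmodule_isComNzRing.Build (fps K)
    fps_mulA fps_mulC fps_mul1 fps_mulD fps_oner_neq0.

Definition fps_unit : {pred fps K} := [pred f | f`[0] != 0].

(* The first [n] coefficients of 1/f, from f_0 g_n = [n = 0] - sum_(i<n) f_(n-i) g_i. *)
Fixpoint fps_inv_coefs f (n : nat) : seq K :=
  if n is m.+1 then
    let s := fps_inv_coefs f m in
    rcons s (((m == 0)%:R - \sum_(i < m) f`[m - i] * s`_i) / f`[0])
  else [::].

Definition fps_inv f : fps K :=
  if f`[0] == 0 then f else Fps (fun n => (fps_inv_coefs f n.+1)`_n).

Lemma size_fps_inv_coefs f n : size (fps_inv_coefs f n) = n.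
Proof. by elim: n => //= n IH; rewrite size_rcons IH. Qed.

Lemma nth_fps_inv_coefs f n i : (i < n)%N ->
  (fps_inv_coefs f n)`_i = (fps_inv_coefs f i.+1)`_i.
Proof.
elim: n => // n IH; rewrite ltnS leq_eqVlt => /predU1P[->//|lin].
by rewrite -IH//= nth_rcons size_fps_inv_coefs lin.
Qed.

Fact fps_mulVf : {in fps_unit, left_inverse (1 : fps K) fps_inv *%R}.
Proof.
move=> f; rewrite inE => f0; rewrite mulrC /fps_inv (negbTE f0).
apply: fpsP => n /=; rewrite big_ord_recl subn0.
have -> : (fps_inv_coefs f n.+1)`_n =
    ((n == 0)%:R - \sum_(i < n) f`[n - i] * (fps_inv_coefs f n)`_i) / f`[0].
  by rewrite /= nth_rcons size_fps_inv_coefs ltnn eqxx.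
rewrite mulrC divfK//.
rewrite [X in _ + X](_ : _ = \sum_(i < n) f`[n - i] * (fps_inv_coefs f n)`_i).
  by rewrite subrK; case: n.
rewrite (reindex_inj rev_ord_inj); apply: eq_bigr => i _.
rewrite lift0 [rev_ord i : nat]/= subnSK//; congr (_ * _).
by rewrite subKn 1?ltnW//= [RHS]nth_fps_inv_coefs.
Qed.

Fact fps_unitPl f g : g * f = 1 -> fps_unit f.
Proof.
move=> /(congr1 (fun f => f`[0])) /=; rewrite big_ord1 /= => e.
by apply/eqP => f0; move/eqP: e; rewrite f0 mulr0 eq_sym oner_eq0.
Qed.

Fact fps_inv_out : {in [predC fps_unit], fps_inv =1 id}.
Proof. by move=> f; rewrite !inE negbK /fps_inv => ->. Qed.

HB.instance Definition _ :=
  GRing.ComNzRing_hasMulInverse.Build (fps K) fps_mulVf fps_unitPl fps_inv_out.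

Lemma fps_unitE f : (f \is a GRing.unit) = (f`[0] != 0).
Proof. by []. Qed.

Definition egf (a : nat -> K) : fps K := Fps (fun n => a n / n`!%:R).

Definition fps_exp : fps K := egf (fun=> 1).

(* H_n(u), by comparing coefficients in (1-u)/(e^t-u) = sum_n H_n(u) t^n/n!;
   meaningful for u != 1, when e^t - u is invertible. *)
Definition frobenius_euler (u : K) (n : nat) : K :=
  n`!%:R * (fpsC (1 - u) / (fps_exp - fpsC u))`[n].

Lemma fps_exp_subC_unit (u : K) :
  u != 1 -> fps_exp - fpsC u \is a GRing.unit.
Proof.
by move=> u1; rewrite fps_unitE /= fact0 divr1 subr_eq0 eq_sym.
Qed.

End FpsRing.

Section AbsoluteValues.
Variable R : realType.

Record ultrametric_abs (K : fieldType) (v : K -> R) : Prop := UltrametricAbs {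
  uabs_ge0 : forall x, 0 <= v x;
  uabs_eq0 : forall x, v x = 0 <-> x = 0;
  uabsM : forall x y, v (x * y) = v x * v y;
  uabsD : forall x y, v (x + y) <= Num.max (v x) (v y)
}.

Definition abs_cvg (K : fieldType) (v : K -> R) (u : nat -> K) (l : K) : Prop :=
  (fun n => v (u n - l)) @ \oo --> (0 : R).

Definition abs_cauchy (K : fieldType) (v : K -> R) (u : nat -> K) : Prop :=
  forall e, 0 < e -> exists N, forall m n,
    (N <= m)%N -> (N <= n)%N -> v (u m - u n) < e.

Definition abs_complete (K : fieldType) (v : K -> R) : Prop :=
  forall u, abs_cauchy v u -> exists l, abs_cvg v u l.

Definition is_completion (K L : fieldType) (v : K -> R) (w : L -> R)
    (i : {rmorphism K -> L}) : Prop :=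
  [/\ ultrametric_abs w,
      forall x, w (i x) = v x,
      forall y e, 0 < e -> exists x, w (i x - y) < e
    & abs_complete w].

(* |x|_p = p^(v_p(denominator) - v_p(numerator)) *)
Definition padic_abs (p : nat) (x : rat) : R :=
  if x == 0 then 0
  else p%:R ^+ logn p `|denq x|%N / p%:R ^+ logn p `|numq x|%N.

(* The tower Q -> Q_p -> algebraic closure of Q_p -> C_p, each step with its
   embedding and with an absolute value extending the previous one.  Each step
   is determined by its defining property up to an isometric isomorphism, so
   any inhabitant of this type is "the" field C_p. *)
Record Cp_model (p : nat) := CpModel {
  Qp : fieldType;
  absQp : Qp -> R;
  Q_to_Qp : {rmorphism rat -> Qp};
  Qp_completion : is_completion (padic_abs p) absQp Q_to_Qp;

  Qpbar : closedFieldType;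
  absQpbar : Qpbar -> R;
  Qp_to_Qpbar : {rmorphism Qp -> Qpbar};
  Qpbar_algebraic : forall x, algebraicOver Qp_to_Qpbar x;
  Qpbar_abs : ultrametric_abs absQpbar;
  Qpbar_absE : forall x, absQpbar (Qp_to_Qpbar x) = absQp x;

  Cp : fieldType;
  absCp : Cp -> R;
  Qpbar_to_Cp : {rmorphism Qpbar -> Cp};
  Cp_completion : is_completion absQpbar absCp Qpbar_to_Cp
}.

End AbsoluteValues.

Section UltrametricTheory.
Variables (R : realType) (K : fieldType) (v : K -> R).
Hypothesis vabs : ultrametric_abs v.

Lemma uabs0 : v 0 = 0.
Proof. exact/(uabs_eq0 vabs). Qed.

Lemma uabs1 : v 1 = 1.
Proof.
have v1 : v 1 != 0 by apply/eqP => /(uabs_eq0 vabs) /eqP; rewrite oner_eq0.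
by apply: (mulfI v1); rewrite -(uabsM vabs) !mulr1.
Qed.

Lemma uabsN x : v (- x) = v x.
Proof.
have vN1 : v (-1) = 1.
  apply/eqP; rewrite -sqrp_eq1 ?(uabs_ge0 vabs)// expr2 -(uabsM vabs).
  by rewrite mulrNN mulr1 uabs1.
by rewrite -mulN1r (uabsM vabs) vN1 mul1r.
Qed.

Lemma uabs_nat_le1 n : v n%:R <= 1.
Proof.
elim: n => [|n IH]; first by rewrite uabs0 ler01.
by rewrite -natr1 (le_trans (uabsD vabs _ _))// ge_max IH uabs1 lexx.
Qed.

End UltrametricTheory.

Section Integral.
Variables (R : realType) (p : nat) (M : Cp_model R p).

Definition padic_int : Type := {x : Qp M | absQp x <= 1}.

Lemma absQp_ultrametric : ultrametric_abs (@absQp R p M).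
Proof. by case: (Qp_completion M). Qed.

Lemma absCp_ultrametric : ultrametric_abs (@absCp R p M).
Proof. by case: (Cp_completion M). Qed.

Definition padic_int_nat (n : nat) : padic_int :=
  exist _ n%:R (uabs_nat_le1 absQp_ultrametric n).

Definition Zp_to_Cp (x : padic_int) : Cp M := Qpbar_to_Cp M (Qp_to_Qpbar M (sval x)).

(* [x]_{-q} *)
Definition mq_bracket (q : Cp M) (x : nat) : Cp M :=
  (1 - (- q) ^+ x) / (1 + q).

Definition mq_sum (q : Cp M) (g : padic_int -> Cp M) (N : nat) : Cp M :=
  (mq_bracket q (p ^ N))^-1 *
    \sum_(0 <= x < p ^ N) g (padic_int_nat x) * (- q) ^+ x.

Definition is_mq_integral (q : Cp M) (g : padic_int -> Cp M) (l : Cp M) : Prop :=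
  abs_cvg (@absCp R p M) (mq_sum q g) l.

Definition mq_integrable (q : Cp M) (g : padic_int -> Cp M) : Prop :=
  exists l, is_mq_integral q g l.

(* The limit when it exists (it is then unique), and 0 otherwise. *)
Definition mq_integral (q : Cp M) (g : padic_int -> Cp M) : Cp M :=
  xget 0 [set l | is_mq_integral q g l].

End Integral.

(* Inverses are total functions; those of [p^N]_{-q}, q e^t + 1, q and 1 - u with u = -1/q are
   genuine when p is odd and |q - 1| < 1. *)

Section WellDefined.
Variables (R : realType) (p : nat) (M : Cp_model R p).
Hypothesis p_odd : odd p.
Local Notation v := (@absCp R p M).
Let vabs : ultrametric_abs v := absCp_ultrametric M.

Lemma absCp_nat (n : nat) : v n%:R = padic_abs R p n%:R.
Proof.
have [_ E1 _ _] := Qp_completion M; have [_ E3 _ _] := Cp_completion M.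
by rewrite -E1 -(Qpbar_absE (c := M)) -E3 !rmorph_nat.
Qed.

Lemma absCp_2 : v 2 = 1.
Proof.
rewrite absCp_nat /padic_abs pnatr_eq0 (pmulrn 1 2).
rewrite denq_int numq_int !absz_nat /= logn1 expr0 lognE; case: ifP => [|_].
  by case/and3P=> pp _; rewrite dvdn_prime2// => /eqP p2; move: p_odd; rewrite p2.
by rewrite expr0 divr1.
Qed.

Variable q : Cp M.
Hypothesis q_near1 : v (q - 1) < 1.

Lemma absCp_q : v q = 1.
Proof.
apply/eqP; rewrite eq_le; apply/andP; split.
  rewrite -[q](subrK 1) (le_trans (uabsD vabs _ _))// ge_max (uabs1 vabs) lexx.
  by rewrite ltW.
rewrite leNgt; apply/negP => vq.
have := uabsD vabs q (- (q - 1)).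
by rewrite opprB addrC subrK (uabs1 vabs) -opprB uabsN// leNgt gt_max vq q_near1.
Qed.

Lemma absCp_expq_sub1 n : v (q ^+ n - 1) < 1.
Proof.
elim: n => [|n IH]; first by rewrite expr0 subrr uabs0.
have -> : q ^+ n.+1 - 1 = q * (q ^+ n - 1) + (q - 1).
  by rewrite mulrBr mulr1 -exprS addrA subrK.
by rewrite (le_lt_trans (uabsD vabs _ _))// gt_max uabsM// absCp_q mul1r IH.
Qed.

Lemma expq_add1_neq0 n : 1 + q ^+ n != 0.
Proof.
apply/eqP => e; have := absCp_expq_sub1 n.
have -> : q ^+ n = - 1 by apply/eqP; rewrite -addr_eq0 addrC e.
by rewrite -opprD uabsN// -[1 + 1]/(2%:R) absCp_2 ltxx.
Qed.

Lemma q_neq0 : q != 0.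
Proof.
apply/eqP => q0; have := absCp_q.
by rewrite q0 uabs0// => /eqP; rewrite eq_sym oner_eq0.
Qed.

Lemma mq_bracket_neq0 N : mq_bracket q (p ^ N) != 0.
Proof.
rewrite /mq_bracket exprNn -signr_odd oddX p_odd orbT expr1 mulN1r opprK.
by rewrite mulf_neq0 ?invr_eq0 ?expq_add1_neq0// -[q]expr1 expq_add1_neq0.
Qed.

Lemma gen_denominator_unit : fpsC q * fps_exp (Cp M) + 1 \is a GRing.unit.
Proof.
rewrite fps_unitE /= big_ord1 /= fact0 divr1 mulr1 addrC -[q]expr1.
exact: expq_add1_neq0.
Qed.

Lemma frobenius_euler_arg_neq1 : - q^-1 != 1.
Proof.
have := expq_add1_neq0 1; apply: contra_neq; rewrite expr1 => e.
have -> : q = - 1 by rewrite -[LHS]invrK -(opprK q^-1) e invrN1.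
exact: subrr.
Qed.

End WellDefined.

(* Main.v *)
(** Put E = e^t and P = p^N.  Summing the geometric series of ratio -qE, the
    generating series of the N-th approximating sums is
      G (1 + q^P E^P) / (1 + q^P),   where G = (1 + q) / (qE + 1),
    since P is odd.  It differs from G by G (q^P / (1 + q^P)) (E^P - 1).  The
    factor q^P / (1 + q^P) has absolute value 1, because q^P is close to 1 and
    |2| = 1, and every coefficient of E^P - 1 is divisible by P up to a fixed
    factorial; so the difference tends to 0 coefficientwise. *)

From HB Require Import structures.
Require Import Defs.
From mathcomp Require Import all_boot all_order all_algebra.
From mathcomp Require Import all_classical all_reals all_analysis.
From mathcomp Require Import ring.
Set Implicit Arguments.
Unset Strict Implicit.
Unset Printing Implicit Defensive.
Import Order.TTheory GRing.Theory Num.Theory.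
Import numFieldNormedType.Exports.
Local Open Scope ring_scope.

(** * Exponential series and generating functions over a field of characteristic zero *)

Section FpsConstants.
Variable K : fieldType.

Fact fpsC_is_zmod_morphism : zmod_morphism (@fpsC K).
Proof. by move=> a b; apply: fpsP => -[|n] //=; rewrite subrr. Qed.

Lemma coef_fpsCM (c : K) f n : (fpsC c * f)`[n] = c * f`[n].
Proof.
rewrite /= big_ord_recl subn0 big1 ?addr0// => i _.
by rewrite /= mul0r.
Qed.

Fact fpsC_is_monoid_morphism : monoid_morphism (@fpsC K).
Proof.
split=> // a b; apply: fpsP => n.
by rewrite coef_fpsCM; case: n => //= n; rewrite mulr0.
Qed.

HB.instance Definition _ :=
  GRing.isZmodMorphism.Build K (fps K) (@fpsC K) fpsC_is_zmod_morphism.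
HB.instance Definition _ :=
  GRing.isMonoidMorphism.Build K (fps K) (@fpsC K) fpsC_is_monoid_morphism.

Lemma coef_fps_sum (I : Type) (r : seq I) (F : I -> fps K) n :
  (\sum_(i <- r) F i)`[n] = \sum_(i <- r) (F i)`[n].
Proof. by elim/big_rec2: _ => //= i _ x _ <-. Qed.

Hypothesis char0 : forall n, n.+1%:R != 0 :> K.

Lemma natr_fact_neq0 n : n`!%:R != 0 :> K.
Proof. by case: n`! (fact_gt0 n) => // m _; exact: char0. Qed.

(** This is [e^(mt)]: in the induction on [m], the Cauchy product with one more factor [e^t] is the
    binomial expansion of [(m + 1)^n] divided by [n!]. *)
Lemma coef_fps_expX m n : (fps_exp K ^+ m)`[n] = m%:R ^+ n / n`!%:R.
Proof.
elim: m n => [|m IH] n.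
  by rewrite expr0 expr0n; case: n => [|n] /=; rewrite ?fact0 ?divr1 ?mul0r.
rewrite exprS mulrC /= -natr1 exprDn mulr_suml.
rewrite (reindex_inj rev_ord_inj) /=.
apply: eq_bigr => i _; have lein : (i <= n)%N by rewrite -ltnS.
rewrite subSS subKn// IH expr1n mulr1 div1r.
apply: (mulfI (natr_fact_neq0 n)); rewrite -{1}(bin_fact lein) !natrM -mulr_natr.
by field; rewrite !natr_fact_neq0.
Qed.

Lemma moment_genfun_sub (q : K) (b : fps K) P : odd P -> 1 + q ^+ P != 0 ->
  fpsC q * fps_exp K + 1 \is a GRing.unit ->
  b = fpsC (1 + q) / (fpsC q * fps_exp K + 1) ->
  fpsC (((1 - (- q) ^+ P) / (1 + q))^-1) *
      \sum_(0 <= x < P) (fpsC (- q) * fps_exp K) ^+ x - b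
    = fpsC (q ^+ P / (1 + q ^+ P)) * (b * (fps_exp K ^+ P - 1)).
Proof.
move=> oddP qP0 Du ->; set E := fps_exp K in Du *; set S := \sum_(_ <= _ < _) _.
(* The geometric sum of ratio [-qE] telescopes; oddness of [P] turns [(-q)^P] into [-q^P]. *)
have S_E : S * (fpsC q * E + 1) = 1 + fpsC (q ^+ P) * E ^+ P.
  have := subrX1 (fpsC (- q) * E) P; rewrite -(big_mkord xpredT (fun i => _ ^+ i)).
  rewrite -/S exprMn -rmorphXn exprNn -signr_odd oddP expr1 mulN1r !rmorphN.
  move=> /(congr1 -%R) e.
  by transitivity (- ((- fpsC q * E - 1) * S)); [ring | rewrite -e; ring].
apply: (mulIr Du); rewrite mulrBl -[in X in X - _]mulrA S_E divrK//.
rewrite exprNn -signr_odd oddP expr1 mulN1r opprK invf_div.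
rewrite -[RHS]mulrA [in RHS]mulrAC divrK//.
(* Used with [x = 1 + q], [a = q^P], [w = 1 / (1 + q^P)] and [y = E^P]. Writing the subtracted [x]
   as [x (1 + a) w] leaves a polynomial identity. *)
have alg (x a w y : fps K) : (1 + a) * w = 1 ->
    x * w * (1 + a * y) - x = a * w * (x * (y - 1)).
  move=> e; transitivity (x * w * (1 + a * y) - x * ((1 + a) * w)); last by ring.
  by rewrite e mulr1.
rewrite (rmorphM (@fpsC K) (1 + q)) (rmorphM (@fpsC K) (q ^+ P)); apply: alg.
by rewrite -(rmorph1 (@fpsC K)) -rmorphD -rmorphM divff.
Qed.

(** A factor [q] cancels, since [q e^t + 1 = q (e^t + 1/q)] and [1 + q = q (1 + 1/q)]. *)
Lemma frobenius_euler_genfun (q : K) : q != 0 ->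
  fpsC q * fps_exp K + 1 \is a GRing.unit ->
  fpsC (1 + q) / (fpsC q * fps_exp K + 1) = egf (frobenius_euler (- q^-1)).
Proof.
move=> q0 Du; apply: fpsP => n.
rewrite /= /frobenius_euler mulrAC divff ?natr_fact_neq0// mul1r.
have qq : fpsC q * fpsC q^-1 = 1 by rewrite -rmorphM divff// rmorph1.
have De : fpsC q * fps_exp K + 1 = fpsC q * (fps_exp K - fpsC (- q^-1)).
  by rewrite rmorphN opprK mulrDr qq.
have Du' : fps_exp K - fpsC (- q^-1) \is a GRing.unit.
  by move: Du; rewrite De unitrM => /andP[].
suff -> : fpsC (1 - - q^-1) / (fps_exp K - fpsC (- q^-1)) =
  fpsC (1 + q) / (fpsC q * fps_exp K + 1) by [].
apply: (mulIr Du); rewrite divrK// De mulrCA divrK// -rmorphM.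
by rewrite opprK mulrDr mulr1 divff// addrC.
Qed.

End FpsConstants.

(** * Limits and estimates for an ultrametric absolute value *)

Section AbsoluteValueLimits.
Variables (R : realType) (K : fieldType) (v : K -> R).
Hypothesis vabs : ultrametric_abs v.

(** A sum in place of the maximum is enough: it is applied to a Cauchy product whose number of terms
    does not depend on [N]. *)
Lemma uabs_sum (I : Type) (r : seq I) (F : I -> K) :
  v (\sum_(i <- r) F i) <= \sum_(i <- r) v (F i).
Proof.
elim/big_rec2: _ => [|i y x _ le_xy]; first by rewrite uabs0.
rewrite (le_trans (uabsD vabs _ _))// ge_max lerDl.
by rewrite (le_trans (uabs_ge0 vabs _) le_xy) ler_wpDl ?(uabs_ge0 vabs).
Qed.

Lemma abs_cvg_unique u l l' : abs_cvg v u l -> abs_cvg v u l' -> l = l'.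
Proof.
move=> ul ul'; apply/eqP; rewrite -subr_eq0; apply/eqP/(uabs_eq0 vabs).
apply/eqP; rewrite eq_le (uabs_ge0 vabs) andbT.
have := cvgD ul ul'; rewrite addr0 => ull'.
apply: (ler_cvg_to (f := fun=> v (l - l')) (cvg_cst _) (ull' _)).
apply: nearW => n /=.
have -> : l - l' = (u n - l') + - (u n - l) by ring.
rewrite (le_trans (uabsD vabs _ _))// uabsN// ge_max lerDl lerDr.
by rewrite !(uabs_ge0 vabs).
Qed.

Lemma abs_cvg_geometric u l C r : 0 <= r < 1 ->
  (forall n, v (u n - l) <= C * r ^+ n) -> abs_cvg v u l.
Proof.
move=> /andP[r0 r1] ule; apply: (@squeeze_cvgr _ _ _ _ (fun=> 0) (geometric C r)).
- by apply: nearW => n; rewrite (uabs_ge0 vabs) ule.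
- exact: cvg_cst.
- by apply: cvg_geometric; rewrite ger0_norm.
Qed.

(** The constant term vanishes. For [n > 0] the coefficient is [m * m^(n-1) / n!], and the integer
    [m^(n-1)] has absolute value at most 1. *)
Lemma uabs_coef_fps_expXB1 m n : (forall n, n.+1%:R != 0 :> K) ->
  v (fps_exp K ^+ m - 1)`[n] <= v (n`!%:R^-1) * v m%:R.
Proof.
move=> char0.
have -> : (fps_exp K ^+ m - 1)`[n] = m%:R ^+ n / n`!%:R - (1 : fps K)`[n].
  by rewrite -coef_fps_expX.
case: n => [|n] /=; last first.
  rewrite subr0 (uabsM vabs) mulrC exprS (uabsM vabs).
  rewrite ler_wpM2l ?ler_piMr ?(uabs_ge0 vabs)//.
  by rewrite -natrX uabs_nat_le1.
by rewrite fact0 divr1 subrr uabs0// mulr_ge0 ?(uabs_ge0 vabs).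
Qed.

End AbsoluteValueLimits.

(** * Moments of the measure on the p-adic integers *)

Section Moments.
Variables (R : realType) (p : nat) (M : Cp_model R p).
Hypotheses (p_prime : prime p) (p_odd : odd p).
Local Notation v := (@absCp R p M).
Let vabs : ultrametric_abs v := absCp_ultrametric M.

Lemma Cp_natr_neq0 n : n.+1%:R != 0 :> Cp M.
Proof.
rewrite -(rmorph_nat (Qpbar_to_Cp M)) -(rmorph_nat (Qp_to_Qpbar M)).
by rewrite -(rmorph_nat (Q_to_Qp M)) !fmorph_eq0 pnatr_eq0.
Qed.

Lemma absCp_p_lt1 : v p%:R < 1.
Proof.
rewrite absCp_nat /padic_abs pnatr_eq0 -[p == 0]negbK -lt0n prime_gt0//=.
rewrite (pmulrn (1 : rat)) denq_int numq_int !absz_nat logn1 expr0 logn_prime// eqxx expr1.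
by rewrite div1r invf_lt1 ?ltr0n ?ltr1n ?prime_gt0 ?prime_gt1.
Qed.

Variable q : Cp M.
Hypothesis q_near1 : v (q - 1) < 1.

Lemma absCp_expq n : v (q ^+ n) = 1.
Proof.
elim: n => [|n IH]; first by rewrite expr0 uabs1.
by rewrite exprS uabsM// absCp_q// mul1r.
Qed.

(** If [1 + q^n] were smaller than 1, then so would be [2 = (1 + q^n) - (q^n - 1)], whereas 2 has
    absolute value 1 for odd [p]. *)
Lemma absCp_expq_add1 n : v (1 + q ^+ n) = 1.
Proof.
apply/eqP; rewrite eq_le; apply/andP; split.
  by rewrite (le_trans (uabsD vabs _ _))// ge_max uabs1// absCp_expq lexx.
rewrite leNgt; apply/negP => lt1.
have := uabsD vabs (1 + q ^+ n) (- (q ^+ n - 1)).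
have -> : 1 + q ^+ n + - (q ^+ n - 1) = 2 by ring.
by rewrite absCp_2// uabsN// leNgt gt_max lt1 absCp_expq_sub1.
Qed.

Lemma absCp_expq_div_add1 n : v (q ^+ n / (1 + q ^+ n)) = 1.
Proof.
rewrite -[RHS](absCp_expq n).
rewrite -[in RHS](divfK (expq_add1_neq0 p_odd q_near1 n) (q ^+ n)).
by rewrite [RHS](uabsM vabs) absCp_expq_add1 mulr1.
Qed.

Lemma Zp_to_Cp_nat n : Zp_to_Cp (padic_int_nat M n) = n%:R.
Proof. by rewrite /Zp_to_Cp /= !rmorph_nat. Qed.

(** Passes from moments to series: [x^n] is [n!] times the coefficient of [t^n] in [e^(xt)]. *)
Lemma mq_sum_monomial n N :
  mq_sum q (fun x : padic_int M => Zp_to_Cp x ^+ n) N =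
  n`!%:R * (fpsC (mq_bracket q (p ^ N))^-1 *
    \sum_(0 <= x < p ^ N) (fpsC (- q) * fps_exp (Cp M)) ^+ x)`[n].
Proof.
rewrite coef_fpsCM mulrCA coef_fps_sum mulr_sumr; congr (_ * _).
apply: eq_bigr => x _; rewrite exprMn.
have <- : fpsC ((- q) ^+ x) = fpsC (- q) ^+ x := rmorphXn _ _ _.
rewrite coef_fpsCM.
rewrite coef_fps_expX; last exact: Cp_natr_neq0.
rewrite Zp_to_Cp_nat; field; exact/natr_fact_neq0/Cp_natr_neq0.
Qed.

Lemma is_mq_integral_monomial n :
  is_mq_integral q (fun x : padic_int M => Zp_to_Cp x ^+ n)
    (n`!%:R * (fpsC (1 + q) / (fpsC q * fps_exp (Cp M) + 1))`[n]).
Proof.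
set G : fps (Cp M) := _ / _.
(* [C] bounds the [n]-th coefficient of [G (E^P - 1)] up to the factor [|P| = |p|^N]; it is
   independent of [N], so convergence is geometric of ratio [|p|]. *)
pose C := \sum_(i < n.+1) v G`[i] * v ((n - i)`!%:R^-1).
apply: (@abs_cvg_geometric _ _ _ vabs _ _ C (v p%:R)) => [|N].
  by rewrite (uabs_ge0 vabs) absCp_p_lt1.
rewrite mq_sum_monomial -mulrBr.
have := moment_genfun_sub (_ : odd (p ^ N)) (expq_add1_neq0 p_odd q_near1 (p ^ N))
  (gen_denominator_unit p_odd q_near1) (erefl G).
rewrite oddX p_odd orbT => /(_ isT) /(congr1 (fun f => f`[n])).
rewrite coef_fpsCM => e; rewrite [X in _ * X]e.
rewrite (uabsM vabs) [in X in _ * X](uabsM vabs) absCp_expq_div_add1 mul1r.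
(* The factor [n!] is dropped, its absolute value being at most 1. *)
rewrite (le_trans (ler_piMl _ _)) ?(uabs_ge0 vabs) ?uabs_nat_le1//=.
rewrite (le_trans (uabs_sum vabs _ _))// mulr_suml ler_sum// => i _.
rewrite (uabsM vabs) -mulrA ler_wpM2l ?(uabs_ge0 vabs)//.
have -> : v p%:R ^+ N = v (p ^ N)%:R.
  elim: N {e} => [|N IH]; first by rewrite expr0 expn0 uabs1.
  by rewrite exprS IH expnS natrM uabsM.
exact: (uabs_coef_fps_expXB1 vabs _ _ Cp_natr_neq0).
Qed.

End Moments.

Theorem mainTheorem5 (R : realType) (p : nat) (p_prime : prime p)
    (p_odd : odd p) (M : Cp_model R p) (q : Cp M)
    (q_near1 : absCp (q - 1) < 1) :
  [/\ forall n, mq_integrable q (fun x : padic_int M => Zp_to_Cp x ^+ n),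
      egf (fun n => mq_integral q (fun x : padic_int M => Zp_to_Cp x ^+ n))
        = fpsC (1 + q) / (fpsC q * fps_exp (Cp M) + 1)
    & fpsC (1 + q) / (fpsC q * fps_exp (Cp M) + 1)
        = egf (frobenius_euler (- q^-1))].
Proof.
have Du := gen_denominator_unit p_odd q_near1.
have int_n := is_mq_integral_monomial p_prime p_odd q_near1.
split.
- by move=> n; eexists; exact: int_n.
- apply: fpsP => n.
  (* Since a limit exists, [xget] returns a limit and not the default 0; uniqueness identifies it
     with the computed one. *)
  have := xgetPex 0 (ex_intro _ _ (int_n n)).
  move=> /(abs_cvg_unique (absCp_ultrametric M)) /(_ (int_n n)) /= e.
  rewrite /mq_integral e mulrAC divff ?mul1r//.
  exact/natr_fact_neq0/Cp_natr_neq0.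
- apply: frobenius_euler_genfun => //; first exact: Cp_natr_neq0.
  exact: q_neq0 q_near1.
Qed.
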